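(* Let $\mathbb F$ be a field of characteristic $0$ and let $G$, $H$ be (possibly vertex- and edge-coloured) graphs. Then the following are equivalent: 1. $G$ and $H$ are distinguishable by $k$-WL; 2. there is a degree-$k$ monomial-PC refutation of $\mathsf P_{\mathrm{iso}}(G,H)$ over $\mathbb F$.
   Context: Graphs may have coloured vertices and/or edges; isomorphisms are required to preserve colours. A local isomorphism from $G$ to $H$ is an injective map $\pi$ with domain contained in $V(G)$ and range in $V(H)$ (viewed as a subset of $V(G)\times V(H)$) such that $vv'\in E(G)\iff \pi(v)\pi(v')\in E(H)$ for all $v,v'$ in its domain, and which preserves vertex and edge colours. Standing assumption: $|V(G)|\ge 2$ or $|V(H)|\ge 2$. The system $\mathsf P_{\mathrm{iso}}(G,H)$ in variables $x_{vw}$ ($v\in V(G)$, $w\in V(H)$) consists of the polynomials (each $p$ standing for $p=0$): $\sum_{v\in V(G)}x_{vw}-1$ for all $w\in V(H)$; $\sum_{w\in V(H)}x_{vw}-1$ for all $v\in V(G)$; and $x_{vw}x_{v'w'}$ for all $v,v',w,w'$ such that $\{(v,w),(v',w')\}$ is not a local isomorphism. Polynomial calculus (PC) over $\mathbb F$: a derivation from a set $\mathsf P$ of polynomials is a sequence of polynomials each of which is an axiom (an element of $\mathsf P$, or $x^2-x$ for a variable $x$), or obtained from an earlier $f$ by multiplication ($xf$ for a variable $x$), or from earlier $g,f$ by linear combination ($ag+bf$, $a,b\in\mathbb F$). A refutation is a derivation of $1$; its degree is the maximum degree of a polynomial in it. A monomial-PC derivation is a PC derivation in which every application of the multiplication rule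 $f\mapsto xf$ has $f$ either a monomial or the product of a monomial and an axiom. Bijective $k$-pebble game on $G,H$: positions are sets $\pi\subseteq V(G)\times V(H)$ with $|\pi|\le k$. From the initial position $\pi_0$, Spoiler wins immediately if $|V(G)|\ne|V(H)|$ or $\pi_0$ is not a local isomorphism. Otherwise in each round, from position $\pi_i$, Spoiler picks $\pi\subseteq\pi_i$ with $|\pi|<k$, Duplicator picks a bijection $f:V(G)\to V(H)$, Spoiler picks $v\in V(G)$, and the new position is $\pi\cup\{(v,f(v))\}$; Spoiler wins if this is not a local isomorphism. Duplicator wins if the play lasts forever. By the characterisation used in the paper (Cai–Fürer–Immerman, Hella), ''$k$-WL distinguishes $G$ and $H$'' means exactly that Spoiler has a winning strategy in the bijective $k$-pebble game on $G,H$ with initial position $\emptyset$.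
   Formalization: The equivalence is proved for k ≥ 2; for k = 1 it fails as stated (two isolated red vertices versus two isolated blue ones: Spoiler wins the 1-pebble game, but there is no degree-1 refutation), and k = 0 fails too (2 versus 3 vertices). *)

(* Defs.v *)
From HB Require Import structures.
From mathcomp Require Import all_boot all_order all_algebra.
From mathcomp Require Export mpoly.

Set Implicit Arguments.
Unset Strict Implicit.
Unset Printing Implicit Defensive.

Import GRing.Theory.
Local Open Scope ring_scope.

(* Finite simple graphs with vertex colours in VC and edge colours in EC.  An
   uncoloured graph has VC = EC = unit; the value of [ecol] on a pair that is
   not an edge is junk and is never used. *)
Record cgraph (VC EC : eqType) : Type := CGraph {
  vertex :> finType;
  adj : rel vertex;
  adj_sym : ssrbool.symmetric adj;
  adj_irr : irreflexive adj;
  vcol : vertex -> VC;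
  ecol : vertex -> vertex -> EC;
  ecol_sym : forall u v, adj u v -> ecol u v = ecol v u
}.

Arguments adj {VC EC c} _ _.
Arguments vcol {VC EC c} _.
Arguments ecol {VC EC c} _ _.

Section LocalIso.
Variables (VC EC : eqType) (G H : cgraph VC EC).

Definition local_iso (pi : {set G * H}) : bool :=
  [&& [forall p in pi, forall q in pi, (p.1 == q.1) ==> (p.2 == q.2)],
      [forall p in pi, forall q in pi, (p.2 == q.2) ==> (p.1 == q.1)],
      [forall p in pi, forall q in pi, adj p.1 q.1 == adj p.2 q.2],
      [forall p in pi, vcol p.1 == vcol p.2]
    & [forall p in pi, forall q in pi,
         adj p.1 q.1 ==> (ecol p.1 q.1 == ecol p.2 q.2)]].

End LocalIso.

Section PebbleGame.
Variables (VC EC : eqType) (G H : cgraph VC EC).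

(* A strategy may depend on the whole history; Spoiler's own earlier moves are
   determined by the strategy, so only Duplicator's bijections are recorded,
   oldest first.  If h lists the bijections of the rounds already played, Spoiler
   keeps [keep S h]; once Duplicator answers f, he picks [place S (rcons h f)]. *)
Record spoiler_strategy : Type := SpoilerStrategy {
  keep : seq {ffun G -> H} -> {set G * H};
  place : seq {ffun G -> H} -> G
}.

(* Position after n rounds when Duplicator plays F 0, F 1, ... *)
Definition position (S : spoiler_strategy) (pi0 : {set G * H})
    (F : nat -> {ffun G -> H}) (n : nat) : {set G * H} :=
  if n is i.+1 then
    let v := place S (mkseq F i.+1) in (v, F i v) |: keep S (mkseq F i)
  else pi0.

Definition legal_round (k : nat) (S : spoiler_strategy) (pi0 : {set G * H})
    (F : nat -> {ffun G -> H}) (i : nat) : Prop :=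
  (keep S (mkseq F i) \subset position S pi0 F i)
  /\ (#|keep S (mkseq F i)| < k)%N.

Definition winning_strategy (k : nat) (pi0 : {set G * H})
    (S : spoiler_strategy) : Prop :=
  forall F : nat -> {ffun G -> H}, (forall i, bijective (F i)) ->
  exists n : nat,
    (forall i, (i < n)%N -> legal_round k S pi0 F i)
    /\ ~~ local_iso (position S pi0 F n).

Definition spoiler_wins (k : nat) (pi0 : {set G * H}) : Prop :=
  [\/ #|G| <> #|H|, ~~ local_iso pi0
    | exists S : spoiler_strategy, winning_strategy k pi0 S].

Definition WL_distinguishes (k : nat) : Prop := spoiler_wins k set0.

End PebbleGame.

Section PolynomialCalculus.
Variables (F : fieldType) (n : nat).
Local Notation poly := {mpoly F[n]}.

Definition pc_axiom (P : poly -> Prop) (p : poly) : Prop :=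
  P p \/ exists i : 'I_n, p = 'X_i ^+ 2 - 'X_i.

(* One line of a derivation with earlier lines [prev]; the multiplication rule
   may only be applied to polynomials satisfying [M]. *)
Inductive pc_step (M P : poly -> Prop) (prev : seq poly) : poly -> Prop :=
| PCAxiom (p : poly) : pc_axiom P p -> pc_step M P prev p
| PCMul (i : 'I_n) (f : poly) :
    f \in prev -> M f -> pc_step M P prev ('X_i * f)
| PCLin (a b : F) (g f : poly) :
    g \in prev -> f \in prev -> pc_step M P prev (a *: g + b *: f).

Definition derivation_with (M P : poly -> Prop) (s : seq poly) : Prop :=
  forall i : nat, (i < size s)%N -> pc_step M P (take i s) s`_i.

Definition monomial_or_multiple (P : poly -> Prop) (f : poly) : Prop :=
  (exists m : 'X_{1..n}, f = 'X_[m])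
  \/ (exists (m : 'X_{1..n}) (p : poly), pc_axiom P p /\ f = 'X_[m] * p).

Definition monomial_pc_derivation (P : poly -> Prop) (s : seq poly) : Prop :=
  derivation_with (monomial_or_multiple P) P s.

Definition monomial_pc_refutation (P : poly -> Prop) (s : seq poly) : Prop :=
  monomial_pc_derivation P s /\ last 0 s = 1.

Definition derivation_degree (s : seq poly) : nat :=
  (\max_(p <- s) (msize p).-1)%N.

End PolynomialCalculus.

Section Piso.
Variables (VC EC : eqType) (G H : cgraph VC EC) (F : fieldType).

Definition xvar (v : G) (w : H) : {mpoly F[#|{: G * H}|]} :=
  'X_(enum_rank (v, w)).

Inductive Piso : {mpoly F[#|{: G * H}|]} -> Prop :=
| PisoCol (w : H) : Piso ((\sum_(v : G) xvar v w) - 1)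
| PisoRow (v : G) : Piso ((\sum_(w : H) xvar v w) - 1)
| PisoPair (v v' : G) (w w' : H) :
    ~~ local_iso [set (v, w); (v', w')] -> Piso (xvar v w * xvar v' w').

End Piso.

(* Main.v *)
Require Import Defs.
From mathcomp Require Import all_boot all_order all_algebra.
From mathcomp Require Import mpoly ring.

(* Fix a position [sigma] and let [R v w] say that Duplicator survives [n] rounds
   from [sigma] extended by [(v, w)].  Composing strategies shows that [R] is
   difunctional, i.e. a disjoint union of complete bipartite blocks.

   If Spoiler can force a win from [sigma], then [R] has no perfect matching, so
   some block [A x B] is unbalanced.  The row axioms over [A] minus the column
   axioms over [B], multiplied by the monomial of [sigma], give a nonzero
   multiple of that monomial up to monomials derived earlier.

   Conversely, if Duplicator wins, map the monomial of [pi] to [0] when Spoiler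
   wins from [pi] and otherwise to the inverse of the number of Duplicator
   positions with the same domain as [pi].  As all blocks are balanced, this
   linear functional kills every multiple of an axiom of degree at most [k]; it
   vanishes exactly on the monomials of Spoiler's positions, hence it is also
   compatible with multiplying derived monomials.  So it kills every derivable
   polynomial, but not [1]. *)

Set Implicit Arguments.
Unset Strict Implicit.
Unset Printing Implicit Defensive.

Import GRing.Theory.

(** Picking one preimage per point of [B] gives a lift no larger than [B]. It carries the pebbles
    kept in a composed position back to the positions being composed. *)
Lemma subset_imset_lift (aT rT : finType) (h : aT -> rT) (A : {set aT})
    (B : {set rT}) :
  B \subset h @: A ->
  exists C : {set aT}, [/\ C \subset A, h @: C = B & #|C| <= #|B|].
Proof.
move=> sBA.
have [b0 b0B|B0] := pickP [in B]; last first.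
  exists set0; rewrite sub0set imset0 cards0; split=> //.
  by apply/setP=> b; rewrite inE; have /= -> := B0 b.
have /imsetP[a0 a0A _] := subsetP sBA _ b0B.
pose g b := odflt a0 [pick a in A | h a == b].
have gP b : b \in B -> g b \in A /\ h (g b) = b.
  move=> bB; rewrite /g; case: pickP => [a /andP[aA /eqP]|no] //=.
  have /imsetP[a aA eb] := subsetP sBA _ bB.
  by have := no a; rewrite aA eb eqxx.
exists (g @: B); split; last exact: leq_imset_card.
  by apply/subsetP=> _ /imsetP[b /gP[gA _] ->].
apply/setP=> b; apply/imsetP/idP=> [[_ /imsetP[c cB ->] ->]|bB].
  by have [_ ->] := gP _ cB.
by exists (g b); [apply: imset_f | have [] := gP _ bB].
Qed.

Lemma inj_bij_of_card (S T : finType) (f : S -> T) :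
  #|S| = #|T| -> injective f -> bijective f.
Proof. by move=> eST finj; apply: inj_card_bij; rewrite ?eST. Qed.

(** * Local isomorphisms as pairwise conditions *)

Section LocalIsoTheory.
Variables (VC EC : eqType) (G H : cgraph VC EC).
Implicit Types (p q : G * H) (pi sigma : {set G * H}).

Definition compatible p q : bool :=
  [&& (p.1 == q.1) == (p.2 == q.2), adj p.1 q.1 == adj p.2 q.2,
      vcol p.1 == vcol p.2
    & adj p.1 q.1 ==> (ecol p.1 q.1 == ecol p.2 q.2)].

Lemma local_isoP pi :
  reflect (forall p q, p \in pi -> q \in pi -> compatible p q) (local_iso pi).
Proof.
apply: (iffP and5P) => [[i1 i2 i3 i4 i5] p q ppi qpi|comp].
  have h1 := implyP (forallP (implyP (forallP i1 p) ppi) q) qpi.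
  have h2 := implyP (forallP (implyP (forallP i2 p) ppi) q) qpi.
  have h3 := implyP (forallP (implyP (forallP i3 p) ppi) q) qpi.
  have h4 := implyP (forallP i4 p) ppi.
  have h5 := implyP (forallP (implyP (forallP i5 p) ppi) q) qpi.
  rewrite /compatible h3 h4 h5 !andbT.
  by apply/eqP; apply/idP/idP; apply/implyP.
have comp4 p q (ppi : p \in pi) (qpi : q \in pi) := and4P (comp p q ppi qpi).
split; apply/forall_inP=> p ppi; try apply/forall_inP=> q qpi.
- by have [/eqP-> _ _ _] := comp4 p q ppi qpi; apply/implyP.
- by have [/eqP-> _ _ _] := comp4 p q ppi qpi; apply/implyP.
- by have [] := comp4 p q ppi qpi.
- by have [] := comp4 p p ppi ppi.
- by have [] := comp4 p q ppi qpi.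
Qed.

Lemma local_isoS pi sigma : sigma \subset pi -> local_iso pi -> local_iso sigma.
Proof.
move=> /subsetP sub /local_isoP iso; apply/local_isoP=> p q ps qs.
by apply: iso; apply: sub.
Qed.

Lemma local_iso0 : local_iso (set0 : {set G * H}).
Proof. by apply/local_isoP=> p q; rewrite inE. Qed.

Lemma local_iso_fst_inj pi : local_iso pi -> {in pi &, injective fst}.
Proof.
move=> /local_isoP iso [v w] [v' w'] ps qs /= ev; subst v'.
by have /and4P[/eqP/=] := iso _ _ ps qs; rewrite eqxx => /esym/eqP->.
Qed.

(** All conditions are binary, so a failure already shows on two points, possibly equal; this is why
    the pair axioms suffice. *)
Lemma not_local_iso_pair pi : ~~ local_iso pi ->
  exists p q, [/\ p \in pi, q \in pi & ~~ local_iso [set p; q]].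
Proof.
move=> niso.
case: (pickP [pred pq : (G * H) * (G * H) |
  [&& pq.1 \in pi, pq.2 \in pi & ~~ compatible pq.1 pq.2]]).
  move=> [p q] /= /and3P[ppi qpi ncomp]; exists p, q; split=> //.
  by apply: contra ncomp => /local_isoP; apply; rewrite !inE eqxx ?orbT.
move=> no; case/negP: niso; apply/local_isoP=> p q ppi qpi.
by have := no (p, q); rewrite /= ppi qpi => /negbFE.
Qed.

End LocalIsoTheory.

(** * Positions from which Spoiler wins, and strategies *)

Section WinningRegion.
Variables (VC EC : eqType) (G H : cgraph VC EC) (k : nat).
Implicit Types (pi sigma : {set G * H}) (W : {set {set G * H}}).

(** Duplicator's answers range over injections, which are bijections when [#|G| = #|H|]; unequal
    sizes are settled separately. *)
Definition forced W sigma : bool :=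
  [forall f : {ffun G -> H}, injectiveb f ==> [exists v, (v, f v) |: sigma \in W]].

Definition spoiler_step W : {set {set G * H}} :=
  [set pi | ~~ local_iso pi ||
    [exists sigma : {set G * H},
      [&& sigma \subset pi, #|sigma| < k & forced W sigma]]].

(* [spoiler_wins_in n.+1] collects the positions from which Spoiler can enforce
   a win within [n] further rounds. *)
Definition spoiler_wins_in n : {set {set G * H}} := iter n spoiler_step set0.

Lemma spoiler_wins_in0 : spoiler_wins_in 0 = set0. Proof. by []. Qed.

Lemma spoiler_wins_inS n :
  spoiler_wins_in n.+1 = spoiler_step (spoiler_wins_in n).
Proof. by []. Qed.

(** [fixset] iterates [spoiler_step] from [set0] exactly [#|{set G * H}|] times, so the region is
    itself one of the stages [spoiler_wins_in]. *)
Definition spoiler_region : {set {set G * H}} := fixset spoiler_step.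

Lemma forcedP W sigma :
  reflect (forall f : {ffun G -> H}, injective f ->
             exists v, (v, f v) |: sigma \in W) (forced W sigma).
Proof.
apply: (iffP forallP) => [fo f /injectiveP finj|fo f].
  exact/existsP/(implyP (fo f)).
by apply/implyP=> /injectiveP/fo/existsP.
Qed.

Lemma not_forcedP W sigma :
  reflect (exists2 f : {ffun G -> H}, injective f &
             forall v, (v, f v) |: sigma \notin W) (~~ forced W sigma).
Proof.
apply: (iffP forallPn) => [[f]|[f finj no]].
  rewrite negb_imply => /andP[/injectiveP finj /existsPn no].
  by exists f.
by exists f; rewrite negb_imply; apply/andP; split; [apply/injectiveP|apply/existsPn].
Qed.

Lemma spoiler_stepP W pi :
  reflect (~~ local_iso pi \/ exists sigma,
             [/\ sigma \subset pi, #|sigma| < k & forced W sigma])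
    (pi \in spoiler_step W).
Proof.
rewrite inE; apply: (iffP orP) => -[niso|ex]; [by left| |by left|]; right.
  by case/existsP: ex => sigma /and3P[]; exists sigma.
by case: ex => sigma [*]; apply/existsP; exists sigma; apply/and3P.
Qed.

Lemma notin_spoiler_stepP W pi :
  reflect (local_iso pi /\ forall sigma, sigma \subset pi -> #|sigma| < k ->
             ~~ forced W sigma)
    (pi \notin spoiler_step W).
Proof.
rewrite inE negb_or negbK.
apply: (iffP andP) => [[iso /existsPn no]|[iso no]]; split=> //.
  by move=> sigma sub card; have := no sigma; rewrite sub card.
by apply/existsPn=> sigma; apply/and3P=> -[sub card]; apply/negP; apply: no.
Qed.

Lemma spoiler_step_mono : {homo spoiler_step : X Y / X \subset Y}.
Proof.
move=> X Y /subsetP sXY; apply/subsetP=> pi /spoiler_stepP[niso|].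
  by apply/spoiler_stepP; left.
case=> sigma [sub card /forcedP fo]; apply/spoiler_stepP; right.
exists sigma; split=> //; apply/forcedP=> f /fo[v vX].
by exists v; apply: sXY.
Qed.

Lemma spoiler_regionE : spoiler_step spoiler_region = spoiler_region.
Proof. exact/fixsetK/spoiler_step_mono. Qed.

(** Extra pebbles preserve a failure of local isomorphism, and otherwise Spoiler can discard
    them. *)
Lemma spoiler_regionS pi sigma :
  sigma \subset pi -> sigma \in spoiler_region -> pi \in spoiler_region.
Proof.
move=> sub; rewrite -spoiler_regionE => /spoiler_stepP[niso|[tau [sub' *]]].
  by apply/spoiler_stepP; left; apply: contra niso; apply: local_isoS.
by apply/spoiler_stepP; right; exists tau; split=> //; apply: subset_trans sub.
Qed.

Lemma spoiler_region_local_iso pi : pi \notin spoiler_region -> local_iso pi.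
Proof. by rewrite -spoiler_regionE => /notin_spoiler_stepP[]. Qed.

Lemma duplicator_reply pi : pi \notin spoiler_region -> #|pi| < k ->
  exists2 f : {ffun G -> H}, injective f &
    forall v, (v, f v) |: pi \notin spoiler_region.
Proof.
rewrite -{1}spoiler_regionE => /notin_spoiler_stepP[_ nofo] card.
exact/not_forcedP/nofo.
Qed.

Hypothesis eqGH : #|G| = #|H|.

(* Duplicator composes three of her strategies: a reply from [a] to [b] is the
   composite [a -> b' -> a' -> b] of her bijections along the rows of [T]. *)
Lemma spoiler_wins_in_difunctional n (T : {set (G * G) * (H * H)}) :
  [set (t.1.1, t.2.2) | t in T] \notin spoiler_wins_in n ->
  [set (t.1.2, t.2.2) | t in T] \notin spoiler_wins_in n ->
  [set (t.1.2, t.2.1) | t in T] \notin spoiler_wins_in n ->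
  [set (t.1.1, t.2.1) | t in T] \notin spoiler_wins_in n.
Proof.
elim: n T => [|n IHn] T; first by rewrite spoiler_wins_in0 !inE.
rewrite !spoiler_wins_inS.
move=> /notin_spoiler_stepP[/local_isoP iso1 no1].
move=> /notin_spoiler_stepP[/local_isoP iso2 no2].
move=> /notin_spoiler_stepP[/local_isoP iso3 no3].
apply/notin_spoiler_stepP; split.
  apply/local_isoP=> _ _ /imsetP[s sT ->] /imsetP[t tT ->].
  have /and4P[/=/eqP e1 /eqP a1 /eqP c1 i1] := iso1 _ _
    (imset_f (fun t => (t.1.1, t.2.2)) sT) (imset_f (fun t => (t.1.1, t.2.2)) tT).
  have /and4P[/=/eqP e2 /eqP a2 /eqP c2 i2] := iso2 _ _
    (imset_f (fun t => (t.1.2, t.2.2)) sT) (imset_f (fun t => (t.1.2, t.2.2)) tT).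
  have /and4P[/=/eqP e3 /eqP a3 /eqP c3 i3] := iso3 _ _
    (imset_f (fun t => (t.1.2, t.2.1)) sT) (imset_f (fun t => (t.1.2, t.2.1)) tT).
  apply/and4P; split=> /=.
  - by rewrite e1 -e2 e3.
  - by rewrite a1 -a2 a3.
  - by rewrite c1 -c2 c3.
  apply/implyP=> ad; rewrite (eqP (implyP i1 ad)).
  rewrite a1 -a2 in ad.
  by rewrite -(eqP (implyP i2 ad)) (eqP (implyP i3 ad)).
(* The kept pebbles come from a set [T'] of rows with no more rows than pebbles, so the projections
   of [T'] are legal choices in the three given positions. *)
move=> _ /subset_imset_lift[T' [sT' <- card']] ltk.
have lt' := leq_ltn_trans card' ltk.
have lift (h : (G * G) * (H * H) -> G * H) :
    (h @: T' \subset h @: T) /\ #|h @: T'| < k.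
  by split; [apply: imsetS | apply: leq_ltn_trans (leq_imset_card _ _) lt'].
have [s1 c1] := lift (fun t => (t.1.1, t.2.2)).
have [s2 c2] := lift (fun t => (t.1.2, t.2.2)).
have [s3 c3] := lift (fun t => (t.1.2, t.2.1)).
have /not_forcedP[f1 f1inj f1P] := no1 _ s1 c1.
have /not_forcedP[f2 f2inj f2P] := no2 _ s2 c2.
have /not_forcedP[f3 f3inj f3P] := no3 _ s3 c3.
have [g2 f2K g2K] := inj_bij_of_card eqGH f2inj.
apply/not_forcedP; exists [ffun v => f3 (g2 (f1 v))] => [v v'|v].
  by rewrite !ffunE => /f3inj/(can_inj g2K)/f1inj.
have := IHn (((v, g2 (f1 v)), (f3 (g2 (f1 v)), f1 v)) |: T').
rewrite !imsetU1 /= ffunE => IH; apply: IH; [exact: f1P| |exact: f3P].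
by have := f2P (g2 (f1 v)); rewrite g2K.
Qed.


Lemma spoiler_region_difunctional (T : {set (G * G) * (H * H)}) :
  [set (t.1.1, t.2.2) | t in T] \notin spoiler_region ->
  [set (t.1.2, t.2.2) | t in T] \notin spoiler_region ->
  [set (t.1.2, t.2.1) | t in T] \notin spoiler_region ->
  [set (t.1.1, t.2.1) | t in T] \notin spoiler_region.
Proof. exact: spoiler_wins_in_difunctional. Qed.

Lemma injective_ffun_of_card : exists f : {ffun G -> H}, injective f.
Proof.
exists [ffun v => enum_val (cast_ord eqGH (enum_rank v))] => v v'.
by rewrite !ffunE => /enum_val_inj/cast_ord_inj/enum_rank_inj.
Qed.

(** Outside the region Duplicator has a reply that keeps every placement outside it. Played against
    [S], these replies keep the game on local isomorphisms as long as [S] moves legally, so [S] does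
    not win. *)
Lemma winning_strategy_in_region (S : spoiler_strategy G H) :
  winning_strategy k set0 S -> set0 \in spoiler_region.
Proof.
move=> win; apply/negPn/negP=> nin.
have [f0 f0inj] := injective_ffun_of_card.
pose good sigma (f : {ffun G -> H}) :=
  injectiveb f && [forall v, (v, f v) |: sigma \notin spoiler_region].
pose reply sigma := odflt f0 [pick f | good sigma f].
pose hist n := iter n (fun h => rcons h (reply (keep S h))) [::].
pose F i := reply (keep S (hist i)).
have histE n : mkseq F n = hist n.
  by elim: n => [|n IHn] //; rewrite mkseqS IHn.
have reply_bij sigma : bijective (reply sigma).
  apply: inj_bij_of_card eqGH _; rewrite /reply.
  by case: pickP => [f /andP[/injectiveP]|].
have [n [legal niso]] := win F (fun i => reply_bij _).
suff pos m : m <= n -> position S set0 F m \notin spoiler_region.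
  by move: niso; rewrite (spoiler_region_local_iso (pos n _)).
elim: m => [|m IHm] lt_mn //.
have [sub card] := legal m lt_mn.
have keepN : keep S (mkseq F m) \notin spoiler_region.
  by apply: contra (IHm (ltnW lt_mn)); apply: spoiler_regionS.
have [f finj fP] := duplicator_reply keepN card.
rewrite /position /F /= -histE /reply; case: pickP => [g|/(_ f)] /=.
  by case/andP=> _ /forallP; apply.
suff -> : good (keep S (mkseq F m)) f by [].
by apply/andP; split; [apply/injectiveP|apply/forallP].
Qed.

(* The second component of [state] counts down the rounds that are left. *)
Lemma region_winning_strategy :
  set0 \in spoiler_region -> exists S : spoiler_strategy G H, winning_strategy k set0 S.
Proof.
move=> reg0.
have [v0 _] : exists v0 : G, true.
  move: reg0; rewrite -spoiler_regionE => /spoiler_stepP[|[sigma [_ _ /forcedP fo]]].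
    by rewrite local_iso0.
  by have [f /fo[v _]] := injective_ffun_of_card; exists v.
have [N reg] : exists N, set0 \in spoiler_wins_in N by exists #|{set G * H}|.
pose kp n pi := odflt set0 [pick sigma : {set G * H} |
  [&& sigma \subset pi, #|sigma| < k & forced (spoiler_wins_in n) sigma]].
pose pl n sigma (f : {ffun G -> H}) :=
  odflt v0 [pick v | (v, f v) |: sigma \in spoiler_wins_in n].
pose step (st : {set G * H} * nat * G) (f : {ffun G -> H}) :=
  let n := st.1.2.-1 in let sigma := kp n st.1.1 in let v := pl n sigma f in
  ((v, f v) |: sigma, n, v).
pose state h := foldl step (set0, N, v0) h.
pose S := SpoilerStrategy (fun h => kp (state h).1.2.-1 (state h).1.1)
                          (fun h => (state h).2).
exists S => F Fbij.
have stateS n : state (mkseq F n.+1) = step (state (mkseq F n)) (F n).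
  by rewrite mkseqS /state -cats1 foldl_cat.
have posE n : position S set0 F n = (state (mkseq F n)).1.1.
  by case: n => [|n] //; rewrite stateS /position [place _ _]/= stateS.
have rankE n : (state (mkseq F n)).1.2 = N - n.
  by elim: n => [|n IHn]; rewrite ?subn0 // stateS /= IHn subnS.
(* Invariant after [n] rounds: either Spoiler has already won legally, or all [n] rounds were legal
   and the position lies in stage [N - n]. At [n = N] the second case is absurd, stage [0] being
   empty. *)
suff [//|[_]] : (exists m, (forall i, i < m -> legal_round k S set0 F i)
      /\ ~~ local_iso (position S set0 F m)) \/
    ((forall i, i < N -> legal_round k S set0 F i)
      /\ position S set0 F N \in spoiler_wins_in (N - N)).
  by rewrite subnn spoiler_wins_in0 inE.
have : N <= N by []; elim: {1 3 4 6}N => [|n IHn] ltnN.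
  by right; split; rewrite ?subn0.
have [ex|[legal pos]] := IHn (ltnW ltnN); first by left.
case isoP: (local_iso (position S set0 F n)); last first.
  by left; exists n; rewrite isoP.
move: pos; rewrite -(subnSK ltnN) spoiler_wins_inS.
case/spoiler_stepP=> [|[sigma [sub card fo]]]; first by rewrite isoP.
set r := N - n.+1 in fo *.
have rE : (state (mkseq F n)).1.2.-1 = r by rewrite rankE /r subnS.
set kp' := kp r (position S set0 F n).
have [sub' card' fo'] : [/\ kp' \subset position S set0 F n, #|kp'| < k
                        & forced (spoiler_wins_in r) kp'].
  rewrite /kp' /kp; case: pickP => [tau /and3P[] //|/(_ sigma)].
  by rewrite sub card fo.
have keepE : keep S (mkseq F n) = kp' by rewrite /= rE -posE.
right; split=> [i|].
  rewrite ltnS leq_eqVlt => /predU1P[->|/legal //].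
  by split; rewrite keepE.
rewrite posE stateS /step /= rE -posE -/kp' /pl.
case: pickP => [//|no]; have /forcedP/(_ (F n) (bij_inj (Fbij n)))[v vin] := fo'.
by have := no v; rewrite vin.
Qed.

End WinningRegion.

(** Difunctionality makes two neighbourhoods [B a] equal or disjoint, so [R] splits into blocks
    [A a] by [B a]. If all were balanced, bijections inside the blocks would glue to a matching. *)
Lemma difunctional_unbalanced_block (S T : finType) (R : S -> T -> bool) :
  (forall a a' b b', R a b' -> R a' b' -> R a' b -> R a b) ->
  ~ (exists2 f : {ffun S -> T}, injective f & forall a, R a (f a)) ->
  exists (A : {set S}) (B : {set T}),
    [/\ #|A| != #|B|, forall a b, a \in A -> b \notin B -> ~~ R a b
      & forall a b, a \notin A -> b \in B -> ~~ R a b].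
Proof.
move=> difR nomatch.
pose B a := [set b | R a b]; pose A a := [set a' | B a' == B a].
have BE a a' b : b \in B a -> b \in B a' -> B a = B a'.
  rewrite !inE => Rab Ra'b; apply/setP=> c; rewrite !inE.
  by apply/idP/idP=> ?; [apply: (difR _ a _ b) | apply: (difR _ a' _ b)].
have [a neq|eqc] := pickP (fun a => #|A a| != #|B a|).
  exists (A a), (B a); split=> // [a' b|a' b].
    by rewrite inE => /eqP <-; rewrite inE.
  move=> na' bB; apply: contra na' => Ra'b; rewrite inE.
  by apply/eqP; apply: (BE _ _ b) => //; rewrite inE.
case: nomatch.
have eqAB a : #|A a| = #|B a| by apply/eqP/negbFE/eqc.
have AA a : a \in A a by rewrite inE.
have ex a : exists b, b \in B a.
  by apply/set0Pn; rewrite -card_gt0 -eqAB card_gt0; apply/set0Pn; exists a.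
have [d _] : exists d : S -> T, true by exists (fun a => xchoose (ex a)).
(* The element of index [i] in [A a] goes to that of index [i] in [B a]; balance keeps the index in
   range, so the default [d a] is never returned. *)
pose f := [ffun a => nth (d a) (enum (B a)) (index a (enum (A a)))].
have lt_index a : index a (enum (A a)) < size (enum (B a)).
  by rewrite -cardE -eqAB cardE index_mem mem_enum.
have fB a : f a \in B a by rewrite ffunE -mem_enum mem_nth.
exists f => [a a' eqf|a]; last by have := fB a; rewrite inE.
have eB : B a = B a' by apply: BE (fB a) _; rewrite eqf.
have eA : A a = A a' by apply/setP=> c; rewrite !inE eB.
move: eqf; rewrite !ffunE -eB -eA => /eqP.
have l' : index a' (enum (A a)) < size (enum (B a)) by rewrite eB eA.
rewrite (set_nth_default (d a) _ l') nth_uniq ?enum_uniq // => /eqP ei.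
by rewrite -(nth_index a (_ : a \in enum (A a))) ?mem_enum // ei nth_index // mem_enum eA.
Qed.

(** * Degree-bounded monomial-PC derivability *)

Section Derivable.
Variables (F : fieldType) (n : nat) (P : {mpoly F[n]} -> Prop) (k : nat).
Local Open Scope ring_scope.
Local Notation poly := {mpoly F[n]}.
Implicit Types (f g p : poly) (s : seq poly) (m : 'X_{1..n}).

(** For a nonzero polynomial [msize] is the degree plus one, hence the bound [k.+1]. Linear
    combinations carry no bound because they cannot raise the degree. *)
Inductive derivable : poly -> Prop :=
| DerAxiom p : pc_axiom P p -> (msize p <= k.+1)%N -> derivable p
| DerMul (i : 'I_n) f : derivable f -> monomial_or_multiple P f ->
    (msize ('X_i * f) <= k.+1)%N -> derivable ('X_i * f)
| DerLin (a b : F) g f : derivable g -> derivable f ->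
    derivable (a *: g + b *: f).

Lemma derivation_degreeP s :
  reflect (forall p, p \in s -> (msize p <= k.+1)%N)
          (derivation_degree s <= k)%N.
Proof.
apply: (iffP (bigmax_leqP_seq _ _ _ _)) => deg p ps.
  by have := deg p ps isT; rewrite -subn1 leq_subLR add1n.
by rewrite -subn1 leq_subLR add1n deg.
Qed.

Lemma pc_step_sub (M : poly -> Prop) s s' f :
  {subset s <= s'} -> pc_step M P s f -> pc_step M P s' f.
Proof.
move=> sub [p ax|i h hs Mh|a b g h gs hs]; first exact: PCAxiom.
  by apply: PCMul => //; apply: sub.
by apply: PCLin; apply: sub.
Qed.

Lemma derivation_cat (M : poly -> Prop) s s' :
  derivation_with M P s -> derivation_with M P s' -> derivation_with M P (s ++ s').
Proof.
move=> ds ds' i; rewrite size_cat nth_cat take_cat.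
have [/ds //|le_si lti] := ltnP i (size s).
have lt' : (i - size s < size s')%N by rewrite ltn_subLR.
by apply: pc_step_sub (ds' _ lt') => x xs; rewrite mem_cat xs orbT.
Qed.

Lemma derivation_rcons (M : poly -> Prop) s f :
  derivation_with M P s -> pc_step M P s f -> derivation_with M P (rcons s f).
Proof.
move=> ds sf i; rewrite size_rcons ltnS nth_rcons => le_is.
have [lti|gei] := ltnP i (size s).
  by rewrite -cats1 takel_cat ?(ltnW lti) //; apply: ds.
have -> : i = size s by apply/eqP; rewrite eqn_leq le_is.
by rewrite eqxx -cats1 take_size_cat.
Qed.

Lemma derivableP f :
  derivable f <-> exists s, [/\ monomial_pc_derivation P (rcons s f)
                             & (derivation_degree (rcons s f) <= k)%N].
Proof.
split.
  elim=> [p ax sz|i g _ [s [ds /derivation_degreeP deg]] Mg sz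
         |a b g h _ [s [ds /derivation_degreeP deg]]
                  _ [s' [ds' /derivation_degreeP deg']]].
  - exists [::]; split; last by apply/derivation_degreeP=> q; rewrite inE => /eqP->.
    by apply: derivation_rcons => //; apply: PCAxiom.
  - exists (rcons s g); split.
      by apply: derivation_rcons => //; apply: PCMul; rewrite // mem_rcons mem_head.
    by apply/derivation_degreeP=> q; rewrite mem_rcons inE => /predU1P[->//|/deg].
  - exists (rcons s g ++ rcons s' h); split.
      apply: derivation_rcons; first exact: derivation_cat.
      by apply: PCLin; rewrite mem_cat !mem_rcons !mem_head ?orbT.
    apply/derivation_degreeP=> q; rewrite mem_rcons inE mem_cat.
    case/predU1P=> [->|/orP[/deg|/deg'] //].
    apply: leq_trans (msizeD_le _ _) _; rewrite geq_max.
    apply/andP; split; apply: leq_trans (msizeZ_le _ _) _; [apply: deg|apply: deg'];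
    by rewrite mem_rcons mem_head.
case=> s [ds /derivation_degreeP deg].
suff der i : (i < size (rcons s f))%N -> derivable (rcons s f)`_i.
  by have := der (size s); rewrite size_rcons nth_rcons ltnn eqxx; apply.
elim/ltn_ind: i => i IHi lti.
have mem_take g : g \in take i (rcons s f) -> derivable g.
  move=> /(nthP 0)[j]; rewrite size_take lti => ltj <-.
  by rewrite nth_take //; apply: IHi => //; apply: ltn_trans lti.
have := deg _ (mem_nth 0 lti).
case: (ds i lti) => [p ax|j h hs Mh|a b g h gs hs] sz.
- exact: DerAxiom.
- by apply: DerMul => //; apply: mem_take.
- by apply: DerLin; apply: mem_take.
Qed.

Lemma derivableZ a f : derivable f -> derivable (a *: f).
Proof. by move=> df; have := DerLin a 0 df df; rewrite scale0r addr0. Qed.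

Lemma derivableD f g : derivable f -> derivable g -> derivable (f + g).
Proof. by move=> df dg; have := DerLin 1 1 df dg; rewrite !scale1r. Qed.

Lemma derivableB f g : derivable f -> derivable g -> derivable (f - g).
Proof. by move=> df dg; have := DerLin 1 (-1) df dg; rewrite scale1r scaleN1r. Qed.

Lemma derivable_sum (I : finType) (A : pred I) (h : I -> poly) :
  derivable 0 -> (forall i, A i -> derivable (h i)) ->
  derivable (\sum_(i | A i) h i).
Proof. by move=> d0 dh; apply: big_ind => // *; apply: derivableD. Qed.

Lemma mnm_split m : m != 0%MM -> exists i m', m = (U_(i) + m')%MM.
Proof.
move=> nz; have [i mi|m0] := pickP (fun i => m i != 0%N).
  exists i, (m - U_(i))%MM; rewrite addmC submK //.
  by apply/mnm_lepP=> j; rewrite mnm1E; case: eqP => // <-; rewrite lt0n.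
by case/eqP: nz; apply/mnmP=> i; rewrite mnm0E; apply/eqP/negbFE/m0.
Qed.

Lemma mnm_ind_addU (Q : 'X_{1..n} -> Prop) :
  Q 0%MM -> (forall i m, Q m -> Q (U_(i) + m)%MM) -> forall m, Q m.
Proof.
move=> Q0 QU m; move: {2}(mdeg m) (erefl (mdeg m)) => d.
elim: d m => [|d IHd] m dm; first by move/eqP: dm; rewrite mdeg_eq0 => /eqP->.
have [|i [m' em]] := @mnm_split m; first by rewrite -mdeg_eq0 dm.
by rewrite em; apply/QU/IHd; move: dm; rewrite em mdegD mdeg1 => -[].
Qed.

Lemma derivable_mul_monomial m m' : derivable 'X_[m'] ->
  (mdeg (m + m') <= k)%N -> derivable 'X_[m + m'].
Proof.
move=> d'; elim/mnm_ind_addU: m => [|i m IHm]; first by rewrite add0m.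
rewrite -addmA mdegD mdeg1 add1n => lt; rewrite mpolyXD.
apply: DerMul; first exact/IHm/ltnW.
  by left; exists (m + m')%MM.
by rewrite -mpolyXD msizeX mdegD mdeg1.
Qed.

(** Multiplying in one variable at a time, each intermediate product is a monomial times the axiom,
    as the restricted rule demands. *)
Lemma derivable_mul_axiom m p : pc_axiom P p ->
  (mdeg m + msize p <= k.+1)%N -> derivable ('X_[m] * p).
Proof.
have szM m' : p != 0 -> msize ('X_[m'] * p) = (mdeg m' + msize p)%N.
  by move=> nz; rewrite msizeM // ?msizeX // -msize_poly_eq0 msizeX.
move=> ax; elim/mnm_ind_addU: m => [|i m IHm].
  by rewrite mdeg0 mpolyX0 mul1r => sz; apply: DerAxiom.
rewrite mdegD mdeg1 -addnA add1n => lt.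
rewrite mpolyXD -mulrA; apply: DerMul; first exact/IHm/ltnW.
  by right; exists m, p.
have [->|nz] := eqVneq p 0; first by rewrite !mulr0 msize0.
by rewrite mulrA -mpolyXD szM // mdegD mdeg1 -addnA.
Qed.

End Derivable.

(** * Positions versus monomials *)

Section Monomials.
Variables (V : finType) (F : fieldType).
Local Open Scope ring_scope.
Local Notation mon := 'X_{1..#|{: V}|}.
Implicit Types (pi sigma : {set V}) (m : mon).

Definition set_mnm pi : mon := (\sum_(p in pi) U_(enum_rank p))%MM.

(** The support of a monomial: forgetting exponents identifies the powers of a variable, in
    accordance with the axioms [x^2 - x]. *)
Definition mnm_set m : {set V} := [set p | (0 < m (enum_rank p))%N].

Lemma mdeg_set_mnm pi : mdeg (set_mnm pi) = #|pi|.
Proof.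
rewrite /set_mnm mdeg_sum -[RHS]sum1_card.
by apply: eq_bigr => p _; rewrite mdeg1.
Qed.

Lemma set_mnm0 : set_mnm set0 = 0%MM.
Proof. by rewrite /set_mnm big_set0. Qed.

Lemma set_mnm1 p : set_mnm [set p] = U_(enum_rank p)%MM.
Proof. by rewrite /set_mnm big_set1. Qed.

Lemma set_mnmU1 p pi : p \notin pi ->
  set_mnm (p |: pi) = (U_(enum_rank p) + set_mnm pi)%MM.
Proof. by move=> np; rewrite /set_mnm big_setU1. Qed.

Lemma set_mnm_subset sigma pi : sigma \subset pi ->
  set_mnm pi = (set_mnm (pi :\: sigma) + set_mnm sigma)%MM.
Proof.
move=> sub; rewrite /set_mnm (big_setID sigma) /= (setIidPr sub).
by rewrite addmC.
Qed.

Lemma mnm_setD m m' : mnm_set (m + m')%MM = mnm_set m :|: mnm_set m'.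
Proof. by apply/setP=> p; rewrite !inE mnmDE addn_gt0. Qed.

Lemma mnm_set0 : mnm_set 0%MM = set0.
Proof. by apply/setP=> p; rewrite !inE mnm0E. Qed.

Lemma mnm_setU p : mnm_set U_(enum_rank p)%MM = [set p].
Proof.
by apply/setP=> q; rewrite !inE mnm1E (inj_eq enum_rank_inj) eq_sym; case: eqP.
Qed.

Lemma card_mnm_set m : (#|mnm_set m| <= mdeg m)%N.
Proof.
rewrite mdegE -[leqLHS]sum1_card (reindex (@enum_rank V)) /=; last first.
  by exists enum_val => p _; rewrite ?enum_rankK ?enum_valK.
rewrite [leqRHS](bigID [in mnm_set m]) /=.
apply: leq_trans (leq_addr _ _); apply: leq_sum => p.
by rewrite inE.
Qed.

End Monomials.

Lemma natr_inj_pchar0 (F : fieldType) : [pchar F]%R =i pred0 ->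
  injective (fun n : nat => n%:R : F)%R.
Proof.
move=> /pcharf0P ch m n.
wlog lemn : m n / m <= n => [th|].
  by have [/th//|/ltnW le e] := leqP m n; apply/esym/th.
move/eqP; rewrite eq_sym -subr_eq0 -natrB // ch subn_eq0 => lenm.
by apply/eqP; rewrite eqn_leq lemn.
Qed.

(** * From Spoiler's win to a refutation *)

Section Completeness.
Variables (F : fieldType) (VC EC : eqType) (G H : cgraph VC EC) (k : nat).
Hypotheses (char0 : [pchar F]%R =i pred0) (k_ge2 : 2 <= k).
Local Open Scope ring_scope.
Implicit Types (pi sigma : {set G * H}).
Local Notation der := (derivable (@Piso VC EC G H F) k).
Local Notation X := (@xvar VC EC G H F).
Local Notation mon pi := ('X_[set_mnm pi] : {mpoly F[#|{: G * H}|]}).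

Lemma msize_linear_axiom (I : finType) n (h : I -> 'I_n) :
  (msize ((\sum_(i : I) 'X_(h i)) - 1 : {mpoly F[n]}) <= 2)%N.
Proof.
apply: leq_trans (msizeD_le _ _) _; rewrite geq_max msizeN msize1 andbT.
apply: leq_trans (msize_sum _ _ _) _; apply/bigmax_leqP=> i _.
by rewrite msizeX mdeg1.
Qed.

Lemma derivable_monS pi sigma : sigma \subset pi -> (#|pi| <= k)%N ->
  der (mon sigma) -> der (mon pi).
Proof.
move=> sub card d; rewrite (set_mnm_subset sub); apply: derivable_mul_monomial => //.
by rewrite -set_mnm_subset // mdeg_set_mnm.
Qed.

Lemma derivable_mon_xvar sigma v w : (#|sigma| < k)%N ->
  der (mon ((v, w) |: sigma)) -> der (mon sigma * X v w).
Proof.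
move=> card; rewrite /xvar mulrC -mpolyXD.
have [ins|nin] := boolP ((v, w) \in sigma).
  have -> : (v, w) |: sigma = sigma by apply/setUidPr; rewrite sub1set.
  by move=> d; apply: derivable_mul_monomial => //; rewrite mdegD mdeg1 mdeg_set_mnm.
by rewrite set_mnmU1.
Qed.

Lemma derivable_not_local_iso pi :
  ~~ local_iso pi -> (#|pi| <= k)%N -> der (mon pi).
Proof.
move=> /not_local_iso_pair[[v w] [[v' w'] [ppi qpi niso]]] card.
suff d : der (mon [set (v, w); (v', w')]).
  by apply: derivable_monS d => //; apply/subsetP=> r /set2P[]->.
have ax : der (X v w * X v' w').
  apply: DerAxiom; first by left; apply: PisoPair.
  by rewrite /xvar -mpolyXD msizeX mdegD !mdeg1.
(* If the two points coincide, the axiom is a square; subtracting [x^2 - x] from it leaves the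
   variable itself. *)
have [e|ne] := eqVneq (v, w) (v', w'); last first.
  by rewrite set_mnmU1 ?inE // set_mnm1 mpolyXD.
case: e ax => <- <- ax; rewrite setUid set_mnm1.
have axb : der (X v w ^+ 2 - X v w).
  apply: DerAxiom; first by right; exists (enum_rank (v, w)).
  apply: leq_trans (msizeD_le _ _) _.
  by rewrite msizeN /xvar mpolyXn !msizeX mdegMn mdeg1.
have := derivableB ax axb.
by rewrite expr2 opprB addrC subrK.
Qed.

(** In the rows over [A] minus the columns over [B], the terms over [A] by [B] cancel and the
    crossing terms are derivable. What remains is a multiple of [mon sigma] by [#|A| - #|B|] up to
    sign, invertible in characteristic [0]. *)
Lemma derivable_unbalanced sigma (A : {set G}) (B : {set H}) :
  (#|sigma| < k)%N -> #|A| != #|B| ->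
  (forall v w, v \in A -> w \notin B -> der (mon sigma * X v w)) ->
  (forall v w, v \notin A -> w \in B -> der (mon sigma * X v w)) ->
  der (mon sigma).
Proof.
move=> card neq dAB dBA; set M := mon sigma in dAB dBA *.
have drow v : der (M * ((\sum_w X v w) - 1)).
  apply: derivable_mul_axiom; first by left; apply: PisoRow.
  rewrite mdeg_set_mnm; apply: leq_trans (leq_add (leqnn _) (msize_linear_axiom _)) _.
  by rewrite addn2.
have dcol w : der (M * ((\sum_v X v w) - 1)).
  apply: derivable_mul_axiom; first by left; apply: PisoCol.
  rewrite mdeg_set_mnm; apply: leq_trans (leq_add (leqnn _) (msize_linear_axiom _)) _.
  by rewrite addn2.
(* Empty sums need [0] to be derivable; as the sizes differ, [A] or [B] has an element whose axiom
   can be scaled by [0]. *)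
have d0 : der 0.
  have [v _|A0] := pickP [in A]; first by have := derivableZ 0 (drow v); rewrite scale0r.
  have [w _|B0] := pickP [in B]; first by have := derivableZ 0 (dcol w); rewrite scale0r.
  by case/eqP: neq; rewrite (eq_card0 A0) (eq_card0 B0).
have nz : #|A|%:R - #|B|%:R != 0 :> F.
  by rewrite subr_eq0; apply: contra neq => /eqP/(natr_inj_pchar0 char0)->.
pose f := (\sum_(v in A) \sum_(w | w \notin B) M * X v w)
  - (\sum_(w in B) \sum_(v | v \notin A) M * X v w)
  - ((\sum_(v in A) M * ((\sum_w X v w) - 1))
     - (\sum_(w in B) M * ((\sum_v X v w) - 1))).
have df : der f.
  by do 2?apply: derivableB; do 2?[apply: derivable_sum => // *]; auto.
suff -> : M = (#|A|%:R - #|B|%:R)^-1 *: f by apply: derivableZ.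
suff -> : f = (#|A|%:R - #|B|%:R) *: M by rewrite scalerA mulVf // scale1r.
have rowE : \sum_(v in A) M * ((\sum_w X v w) - 1) =
    (\sum_(v in A) \sum_(w in B) M * X v w)
    + (\sum_(v in A) \sum_(w | w \notin B) M * X v w) - #|A|%:R *: M.
  under eq_bigr => v _ do rewrite mulrBr mulr1 mulr_sumr (bigID [in B]) /=.
  by rewrite sumrB big_split /= sumr_const scaler_nat.
have colE : \sum_(w in B) M * ((\sum_v X v w) - 1) =
    (\sum_(v in A) \sum_(w in B) M * X v w)
    + (\sum_(w in B) \sum_(v | v \notin A) M * X v w) - #|B|%:R *: M.
  under eq_bigr => w _ do rewrite mulrBr mulr1 mulr_sumr (bigID [in A]) /=.
  by rewrite sumrB big_split /= sumr_const scaler_nat exchange_big.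
rewrite /f rowE colE scalerBl.
move: (_ *: M) (_ *: M) => a b.
move: (\sum_(v in A) \sum_(w in B) _) (\sum_(_ in A) _) (\sum_(_ in B) _) => x y z.
ring.
Qed.

Lemma derivable_card_neq : #|G| != #|H| -> der 1.
Proof.
move=> neq; rewrite -mpolyX0 -set_mnm0.
apply: (@derivable_unbalanced _ setT setT); rewrite ?cardsT ?cards0 //.
- exact: ltnW.
- by move=> v w _; rewrite inE.
- by move=> v w; rewrite inE.
Qed.

Hypothesis eqGH : #|G| = #|H|.

(** Each pebble of [sigma] becomes a diagonal row of [T] and the new vertices form one further row,
    so the four projections of [T] are the four extensions. *)
Lemma extension_difunctional n sigma (v v' : G) (w w' : H) :
  (v, w') |: sigma \notin spoiler_wins_in G H k n ->
  (v', w') |: sigma \notin spoiler_wins_in G H k n ->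
  (v', w) |: sigma \notin spoiler_wins_in G H k n ->
  (v, w) |: sigma \notin spoiler_wins_in G H k n.
Proof.
pose T := ((v, v'), (w, w')) |: [set ((p.1, p.1), (p.2, p.2)) | p in sigma].
have TE (h : (G * G) * (H * H) -> G * H) :
    (forall p, h ((p.1, p.1), (p.2, p.2)) = p) ->
    h @: T = h ((v, v'), (w, w')) |: sigma.
  move=> hP; rewrite imsetU1 -imset_comp (eq_imset _ (g := id)) ?imset_id //.
have := @spoiler_wins_in_difunctional _ _ G H k eqGH n T.
by rewrite !TE => [|[]|[]|[]|[]].
Qed.

(** Induction on the stage: a forcing [sigma] leaves no matching of safe pairs, hence an unbalanced
    block; pairs crossing its border lead to the previous stage, whose monomials are derivable by
    induction. *)
Lemma derivable_spoiler_wins n pi : pi \in spoiler_wins_in G H k n ->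
  (#|pi| <= k)%N -> der (mon pi).
Proof.
elim: n pi => [|n IHn] pi; first by rewrite spoiler_wins_in0 inE.
rewrite spoiler_wins_inS => /spoiler_stepP[niso|[sigma [sub card /forcedP fo]]] cpi.
  exact: derivable_not_local_iso.
apply: (derivable_monS sub cpi).
pose R v w := (v, w) |: sigma \notin spoiler_wins_in G H k n.
have [||A [B [neq AB BA]]] := @difunctional_unbalanced_block G H R.
- by move=> v v' w w'; apply: extension_difunctional.
- by case=> f /fo[v vin] /(_ v); rewrite /R vin.
have dR v w : ~~ R v w -> der (mon sigma * X v w).
  rewrite negbK => /IHn d; apply: derivable_mon_xvar => //; apply: d.
  by rewrite cardsU1; apply: leq_trans (leq_add (leq_b1 _) (leqnn _)) _.
by apply: (derivable_unbalanced card neq) => v w vA wB; apply: dR; auto.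
Qed.

End Completeness.

(** * The linear functional built from Duplicator's safe positions *)

Section DuplicatorMeasure.
Variables (VC EC : eqType) (G H : cgraph VC EC) (k : nat).
Hypothesis eqGH : #|G| = #|H|.
Implicit Types (pi sigma tau : {set G * H}) (A : {set G}).
Local Notation region := (spoiler_region G H k).

Definition safe_extensions pi v : {set H} := [set w | (v, w) |: pi \notin region].

Definition safe_positions A : {set {set G * H}} :=
  [set pi | (pi \notin region) && (fst @: pi == A)].

Lemma card_safe_position pi : pi \notin region -> #|fst @: pi| = #|pi|.
Proof. by move=> /spoiler_region_local_iso/local_iso_fst_inj/card_in_imset. Qed.

(** With [f] and [g] Duplicator's replies at [pi] and [sigma], the map [g] after the inverse of [f]
    sends safe values for [pi] injectively to safe values for [sigma]. *)
Lemma leq_card_safe_extensions pi sigma v :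
  pi \notin region -> sigma \notin region -> fst @: pi = fst @: sigma ->
  #|pi| < k -> #|safe_extensions pi v| <= #|safe_extensions sigma v|.
Proof.
move=> safe_pi safe_sigma eq_dom card.
have card' : #|sigma| < k by rewrite -card_safe_position // -eq_dom card_safe_position.
have [f finj fP] := duplicator_reply safe_pi card.
have [g ginj gP] := duplicator_reply safe_sigma card'.
have [f' fK f'K] := inj_bij_of_card eqGH finj.
have hinj : injective (g \o f') by apply: inj_comp => //; apply: can_inj f'K.
rewrite -(card_imset _ hinj); apply: subset_leq_card.
apply/subsetP=> _ /imsetP[w wP ->]; rewrite inE in wP; rewrite inE /=.
set u := f' w.
(* Each row joins the values of [sigma] and [pi] at a common domain point, so the projections of
   [T0] are [pi], [pi], [sigma] and [sigma], as difunctionality needs. *)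
pose T0 := [set t : (G * G) * (H * H) |
  [&& t.1.1 == t.1.2, (t.1.1, t.2.1) \in sigma & (t.1.2, t.2.2) \in pi]].
have T0pi (h : (G * G) * (H * H) -> G * H) :
    (forall a b b', h ((a, a), (b, b')) = (a, b')) -> h @: T0 = pi.
  move=> hE; apply/setP=> -[a b']; apply/imsetP/idP=> [[[[a1 a2] [b1 b2]]]|inpi].
    by rewrite inE /= => /and3P[/eqP-> _ inpi]; rewrite hE => ->.
  have : a \in fst @: sigma by rewrite -eq_dom; apply/imsetP; exists (a, b').
  case/imsetP=> -[a0 b] insigma /= ea; exists ((a, a), (b, b')).
    by rewrite inE /= eqxx ea insigma -ea.
  by rewrite hE.
have T0sigma (h : (G * G) * (H * H) -> G * H) :
    (forall a b b', h ((a, a), (b, b')) = (a, b)) -> h @: T0 = sigma.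
  move=> hE; apply/setP=> -[a b]; apply/imsetP/idP=> [[[[a1 a2] [b1 b2]]]|insigma].
    by rewrite inE /= => /and3P[/eqP-> insigma _]; rewrite hE => ->.
  have : a \in fst @: pi by rewrite eq_dom; apply/imsetP; exists (a, b).
  case/imsetP=> -[a0 b'] inpi /= ea; exists ((a, a), (b, b')).
    by rewrite inE /= eqxx ea inpi -ea insigma.
  by rewrite hE.
have := spoiler_region_difunctional eqGH (T := ((v, u), (g u, w)) |: T0) (k := k).
rewrite !imsetU1 /= (T0pi (fun t => (t.1.1, t.2.2))) //.
rewrite (T0pi (fun t => (t.1.2, t.2.2))) // (T0sigma (fun t => (t.1.2, t.2.1))) //.
rewrite (T0sigma (fun t => (t.1.1, t.2.1))) // => dif; apply: dif => //.
by have := fP u; rewrite f'K.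
Qed.

Lemma card_safe_extensions pi sigma v :
  pi \notin region -> sigma \notin region -> fst @: pi = fst @: sigma ->
  #|pi| < k -> #|safe_extensions pi v| = #|safe_extensions sigma v|.
Proof.
move=> safe_pi safe_sigma eq_dom card; apply/eqP; rewrite eqn_leq.
rewrite !leq_card_safe_extensions //.
by rewrite -card_safe_position // -eq_dom card_safe_position.
Qed.

(** A safe position over [v |: A] is its restriction to [A] plus a value at [v]. If [v] already lies
    in [A], that value is determined and both counts are one. *)
Lemma card_restriction_fibre A sigma v : sigma \in safe_positions A ->
  #|[set tau in safe_positions (v |: A) | [set p in tau | p.1 \in A] == sigma]|
    = #|safe_extensions sigma v|.
Proof.
rewrite inE => /andP[safe /eqP domA].
have inj_at w tau : (v, w) |: tau \notin region ->
    forall w', (v, w') \in (v, w) |: tau -> w' = w.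
  move=> /spoiler_region_local_iso/local_iso_fst_inj inj w' w'in.
  by have [] := inj _ _ w'in (setU11 _ _) erefl.
rewrite -(@card_in_imset _ _ (fun w => (v, w) |: sigma)); last first.
  move=> w w'; rewrite !inE => safe_w safe_w' e.
  by apply: (inj_at w' sigma) => //; rewrite -e setU11.
apply: eq_card => tau; rewrite !inE.
apply/andP/imsetP=> [[/andP[safe_tau /eqP dom_tau] /eqP res]|[w]].
  have /imsetP[[v' w] vw /= ev] : v \in fst @: tau by rewrite dom_tau setU11.
  subst v'; exists w; last first.
    apply/setP=> -[a b]; rewrite !inE -res inE /=.
    have [ea|na] := eqVneq a v; last first.
      rewrite xpair_eqE (negbTE na) /= andb_idr // => abt.
      have : a \in fst @: tau by apply/imsetP; exists (a, b).
      by rewrite dom_tau !inE (negbTE na).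
    subst a; apply/idP/orP=> [vb|[/eqP->|/andP[]] //].
    have inj := local_iso_fst_inj (spoiler_region_local_iso safe_tau).
    by have [->] := inj _ _ vb vw erefl; left.
  rewrite inE; apply: contra safe_tau; apply: spoiler_regionS.
  by rewrite subUset sub1set vw -res; apply/subsetP=> p; rewrite inE => /andP[].
rewrite inE => safe_w ->; rewrite safe_w imsetU1 domA eqxx; split=> //.
apply/eqP/setP=> -[a b]; rewrite !inE -domA /=.
apply/andP/idP=> [[/predU1P[[-> ->]|//]]|inst].
  case/imsetP=> -[a' b'] in' /= ea; subst a'.
  by rewrite -(inj_at _ _ safe_w b') // setU1r.
by rewrite inst orbT; split=> //; apply/imsetP; exists (a, b).
Qed.

(** Restriction to the old domain has fibres counted by safe extensions; that count depends only on
    the domain, so all fibres have equal size. *)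
Lemma card_safe_positionsU1 pi v : pi \notin region -> #|pi| < k ->
  #|safe_positions (v |: fst @: pi)|
    = #|safe_positions (fst @: pi)| * #|safe_extensions pi v|.
Proof.
move=> safe card; set A := fst @: pi.
rewrite -[LHS]sum1_card
  (partition_big (fun tau => [set p in tau | p.1 \in A]) [in safe_positions A]) /=.
  rewrite -[RHS]sum_nat_const; apply: eq_bigr => sigma insigma.
  rewrite (card_safe_extensions v safe (_ : sigma \notin region)) //; first last.
  - by move: insigma; rewrite inE => /andP[_ /eqP].
  - by move: insigma; rewrite inE => /andP[].
  rewrite -(card_restriction_fibre v insigma) -[RHS]sum1_card.
  by apply: eq_bigl => tau; rewrite [in RHS]inE.
move=> tau; rewrite !inE => /andP[safe_tau /eqP dom_tau]; apply/andP; split.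
  apply: contra safe_tau; apply: spoiler_regionS.
  by apply/subsetP=> p; rewrite inE => /andP[].
apply/eqP/setP=> a; apply/imsetP/idP=> [[p]|aA].
  by rewrite inE => /andP[_ ?] ->.
have /imsetP[p ptau ea] : a \in fst @: tau by rewrite dom_tau setU1r.
by exists p; rewrite // inE ptau -ea.
Qed.

Lemma card_safe_extensions_gt0 pi v : pi \notin region -> #|pi| < k ->
  0 < #|safe_extensions pi v|.
Proof.
move=> safe card; have [f _ fP] := duplicator_reply safe card.
by rewrite card_gt0; apply/set0Pn; exists (f v); rewrite inE.
Qed.

Lemma card_safe_positions_gt0 pi : pi \notin region ->
  0 < #|safe_positions (fst @: pi)|.
Proof.
by move=> safe; rewrite card_gt0; apply/set0Pn; exists pi; rewrite inE safe eqxx.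
Qed.

Lemma safe_extensionsE pi v v' w :
  w \in safe_extensions pi v -> w \in safe_extensions pi v' ->
  safe_extensions pi v = safe_extensions pi v'.
Proof.
rewrite !inE => sv sv'; apply/setP=> w'; rewrite !inE.
apply/idP/idP=> sw'.
  exact: (extension_difunctional eqGH sv' sv sw').
exact: (extension_difunctional eqGH sv sv' sw').
Qed.

(** Duplicator's reply maps the column of [w] bijectively onto the row of [v], so blocks are
    balanced. *)
Lemma card_safe_extensions_col pi v w : pi \notin region -> #|pi| < k ->
  w \in safe_extensions pi v ->
  #|[set v' | w \in safe_extensions pi v']| = #|safe_extensions pi v|.
Proof.
move=> safe card wv; have [f finj fP] := duplicator_reply safe card.
have [f' fK f'K] := inj_bij_of_card eqGH finj.
have fext u : f u \in safe_extensions pi u by rewrite inE.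
rewrite -(card_imset _ finj); apply: eq_card => w'.
apply/imsetP/idP=> [[v' v'w ->]|w'v].
  rewrite inE in v'w; rewrite -(safe_extensionsE v'w wv); exact: fext.
exists (f' w'); rewrite ?f'K // inE.
have := fext (f' w'); rewrite f'K => w'f.
by rewrite (safe_extensionsE w'f w'v).
Qed.

Variable F : fieldType.
Hypothesis char0 : [pchar F]%R =i pred0.
Local Open Scope ring_scope.

(* The probability that the domain of [pi], listed as a tuple, is sent to its
   [pi]-image by a uniformly random choice among the tuples of the same type. *)
Definition weight pi : F :=
  if pi \in region then 0 else (#|safe_positions (fst @: pi)|%:R)^-1.

Lemma weight_extension pi v w : pi \notin region -> (#|pi| < k)%N ->
  weight ((v, w) |: pi) =
  if w \in safe_extensions pi v then
    weight pi / #|safe_extensions pi v|%:R else 0.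
Proof.
move=> safe card; rewrite /weight inE; case: ifP => //= _.
by rewrite (negbTE safe) imsetU1 card_safe_positionsU1 // natrM invfM.
Qed.

Lemma weight_in_region pi sigma :
  pi \in region -> pi \subset sigma -> weight sigma = 0.
Proof. by move=> inr sub; rewrite /weight (spoiler_regionS sub inr). Qed.

Lemma natr_card_safe_extensions_neq0 pi v : pi \notin region -> (#|pi| < k)%N ->
  #|safe_extensions pi v|%:R != 0 :> F.
Proof.
move=> safe card; move/pcharf0P: char0 => ->.
by rewrite -lt0n card_safe_extensions_gt0.
Qed.

Lemma weight_row pi v : (#|pi| < k)%N -> \sum_w weight ((v, w) |: pi) = weight pi.
Proof.
move=> card; have [inr|safe] := boolP (pi \in region).
  rewrite (weight_in_region inr (subxx _)) big1 // => w _.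
  exact: weight_in_region inr (subsetUr _ _).
under eq_bigr => w _ do rewrite weight_extension //.
rewrite -big_mkcond /= sumr_const -[LHS]mulr_natr divfK //.
exact: natr_card_safe_extensions_neq0.
Qed.

(** All rows meeting column [w] coincide, so the nonzero terms are equal, and by balance their
    number is the common denominator. *)
Lemma weight_col pi w : (#|pi| < k)%N -> \sum_v weight ((v, w) |: pi) = weight pi.
Proof.
move=> card; have [inr|safe] := boolP (pi \in region).
  rewrite (weight_in_region inr (subxx _)) big1 // => v _.
  exact: weight_in_region inr (subsetUr _ _).
have [f finj fP] := duplicator_reply safe card.
have [f' fK f'K] := inj_bij_of_card eqGH finj.
have wv0 : w \in safe_extensions pi (f' w).
  by rewrite inE; have := fP (f' w); rewrite f'K.
under eq_bigr => v _ do rewrite weight_extension //.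
rewrite -big_mkcond /=.
rewrite (eq_bigr (fun=> weight pi / #|safe_extensions pi (f' w)|%:R)).
  rewrite sumr_const -[LHS]mulr_natr -(card_safe_extensions_col safe card wv0).
  rewrite (eq_card (B := [set v' | w \in safe_extensions pi v'])).
    rewrite divfK // (card_safe_extensions_col safe card wv0).
    exact: natr_card_safe_extensions_neq0.
  by move=> v; rewrite [RHS]inE.
by move=> v wv; rewrite (safe_extensionsE wv wv0).
Qed.

Local Notation n := #|{: G * H}|.

(** Bounded multinomials make the index type finite; monomials of degree above [k] are sent to [0],
    which keeps the map linear on all polynomials. *)
Definition expectation (f : {mpoly F[n]}) : F :=
  \sum_(m : 'X_{1..n < k.+1}) f@_m * weight (mnm_set m).

Lemma expectation_lin a b f g :
  expectation (a *: f + b *: g) = a * expectation f + b * expectation g.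
Proof.
rewrite /expectation !mulr_sumr -big_split /=; apply: eq_bigr => m _.
by rewrite mcoeffD !mcoeffZ mulrDl !mulrA.
Qed.

Lemma expectationB f g : expectation (f - g) = expectation f - expectation g.
Proof. by rewrite -[f]scale1r -[- _]scaleN1r expectation_lin scale1r mul1r mulN1r. Qed.

Lemma expectation_sum (I : finType) (h : I -> {mpoly F[n]}) :
  expectation (\sum_i h i) = \sum_i expectation (h i).
Proof.
rewrite /expectation exchange_big; apply: eq_bigr => m _ /=.
by rewrite raddf_sum mulr_suml.
Qed.

Lemma expectationX (m : 'X_{1..n}) : expectation 'X_[m] =
  if (mdeg m <= k)%N then weight (mnm_set m) else 0.
Proof.
rewrite /expectation; under eq_bigr => m' _ do rewrite mcoeffX.
case: ifP => [lek|gtk].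
  rewrite (bigD1 (BMultinom (lek : mdeg m < k.+1)%N)) //= eqxx mul1r.
  rewrite big1 ?addr0 // => m' ne; case: eqP => [e|]; rewrite ?mul0r //.
  by case/eqP: ne; apply/val_inj.
rewrite big1 // => m' _; case: eqP => [e|]; rewrite ?mul0r //.
by have := bmdeg m'; rewrite ltnS -e gtk.
Qed.

Lemma expectationX0 (m : 'X_{1..n}) : mnm_set m \in region -> expectation 'X_[m] = 0.
Proof.
by move=> inr; rewrite expectationX (weight_in_region inr (subxx _)) if_same.
Qed.

Lemma mdeg_leq_msize_mulX (m q : 'X_{1..n}) (p : {mpoly F[n]}) d :
  p@_q != 0 -> (msize ('X_[m] * p) <= d.+1)%N -> (mdeg (m + q) <= d)%N.
Proof.
move=> nz sz; rewrite -ltnS; apply: leq_trans sz; apply: msize_mdeg_lt.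
by rewrite mcoeff_msupp mulrC mcoeffMX.
Qed.

Lemma mcoeff_linear_axiom (I : finType) (h : I -> 'I_n) i : injective h ->
  ((\sum_j 'X_(h j)) - 1 : {mpoly F[n]})@_U_(h i) = 1.
Proof.
move=> hinj; rewrite mcoeffB mcoeff1 mnm1_eq0 subr0 raddf_sum /=.
rewrite (bigD1 i) //= mcoeffXU eqxx big1 ?addr0 // => j ne.
by rewrite mcoeffXU (inj_eq hinj) (negbTE ne).
Qed.

Lemma expectation_xvar (m : 'X_{1..n}) v w : (mdeg m < k)%N ->
  expectation ('X_[m] * xvar F v w) = weight ((v, w) |: mnm_set m).
Proof.
move=> lt; rewrite /xvar mulrC -mpolyXD expectationX mdegD mdeg1 lt.
by rewrite mnm_setD mnm_setU.
Qed.

Hypotheses (Gpos : (0 < #|G|)%N).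

Lemma expectation_axiom (m : 'X_{1..n}) p : pc_axiom (@Piso VC EC G H F) p ->
  (msize ('X_[m] * p) <= k.+1)%N -> expectation ('X_[m] * p) = 0.
Proof.
have cardm : (mdeg m < k)%N -> (#|mnm_set m| < k)%N.
  by move=> lt; apply: leq_ltn_trans (card_mnm_set m) lt.
case=> [[w|v|v v' w w' niso]|[i ->]].
(* [G] is nonempty, so the axiom contains a variable; the degree bound then gives [mdeg m < k], as
   [weight_col] requires. *)
- have /card_gt0P[v0 _] := Gpos.
  move/(@mdeg_leq_msize_mulX m U_(enum_rank (v0, w)) _ _).
  rewrite (@mcoeff_linear_axiom _ (fun v => enum_rank (v, w)) v0); last first.
    by move=> v v' /enum_rank_inj[].
  rewrite mdegD mdeg1 addn1 oner_eq0 => /(_ isT) lt.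
  rewrite mulrBr mulr1 expectationB mulr_sumr expectation_sum.
  under eq_bigr => v _ do rewrite expectation_xvar //.
  by rewrite weight_col ?cardm // expectationX ltnW // subrr.
- have /card_gt0P[w0 _] : (0 < #|H|)%N by rewrite -eqGH.
  move/(@mdeg_leq_msize_mulX m U_(enum_rank (v, w0)) _ _).
  rewrite (@mcoeff_linear_axiom _ (fun w => enum_rank (v, w)) w0); last first.
    by move=> w w' /enum_rank_inj[].
  rewrite mdegD mdeg1 addn1 oner_eq0 => /(_ isT) lt.
  rewrite mulrBr mulr1 expectationB mulr_sumr expectation_sum.
  under eq_bigr => w _ do rewrite expectation_xvar //.
  by rewrite weight_row ?cardm // expectationX ltnW // subrr.
- move=> _; rewrite /xvar -!mpolyXD; apply: expectationX0.
  rewrite !mnm_setD !mnm_setU; apply: spoiler_regionS (subsetUr _ _) _.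
  apply/negPn/negP=> /spoiler_region_local_iso iso.
  by rewrite iso in niso.
- rewrite mpolyXn => /(@mdeg_leq_msize_mulX m (U_(i) *+ 2) _ _).
  have ne : (U_(i) == U_(i) *+ 2)%MM = false.
    by apply/eqP=> /(congr1 (@mdeg _)); rewrite mdegMn mdeg1.
  rewrite mcoeffB !mcoeffX eqxx ne subr0 oner_eq0 => /(_ isT) le2.
  have le1 : (mdeg (m + U_(i)) <= k)%N.
    apply: leq_trans le2; by rewrite !mdegD !mdeg1 leq_add2l.
  (* Both monomials have the same support, hence the same weight. *)
  rewrite mulrBr expectationB -!mpolyXD !expectationX le1 le2.
  by rewrite !mnm_setD setUid subrr.
Qed.

Lemma expectation_derivable f : derivable (@Piso VC EC G H F) k f -> expectation f = 0.
Proof.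
elim=> {f} [p ax sz|i f _ E0 Mf sz|a b g f _ Eg _ Ef].
- have := @expectation_axiom 0%MM p ax.
  by rewrite mpolyX0 mul1r; apply.
- case: Mf => [[m ef]|[m [p [ax ef]]]]; last first.
    rewrite ef mulrA -mpolyXD in sz *; exact: expectation_axiom.
  rewrite ef -mpolyXD in sz *; rewrite msizeX ltnS mdegD mdeg1 in sz.
  (* A safe monomial of degree at most [k] has nonzero expectation, a positive count being
     invertible in characteristic [0]. So this derived monomial lies in the region, which is closed
     under adding pebbles. *)
  have inr : mnm_set m \in region.
    apply/negPn/negP=> safe; move/eqP: E0; rewrite ef expectationX ltnW //.
    rewrite /weight (negbTE safe) invr_eq0; move/pcharf0P: char0 => ->.
    by rewrite -leqn0 leqNgt card_safe_positions_gt0.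
  by apply: expectationX0; rewrite mnm_setD; apply: spoiler_regionS inr; apply: subsetUr.
- by rewrite expectation_lin Eg Ef !mulr0 addr0.
Qed.

Lemma derivable1_spoiler_region : derivable (@Piso VC EC G H F) k 1 ->
  set0 \in region.
Proof.
move=> /expectation_derivable; rewrite -mpolyX0 expectationX mdeg0 mnm_set0 /weight.
case: ifP => // safe /eqP; rewrite invr_eq0; move/pcharf0P: char0 => ->.
by rewrite -leqn0 leqNgt card_safe_positions_gt0 // safe.
Qed.

End DuplicatorMeasure.

Theorem theorem1 (F : fieldType) (char0 : [pchar F]%R =i pred0)
    (VC EC : eqType) (G H : cgraph VC EC)
    (size2 : 2 <= #|G| \/ 2 <= #|H|) (k : nat) (k_ge2 : 2 <= k) :
  WL_distinguishes G H k <->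
  exists s : seq {mpoly F[#|{: G * H}|]},
    monomial_pc_refutation (@Piso VC EC G H F) s
    /\ derivation_degree s <= k.
Proof.
have der1P : derivable (@Piso VC EC G H F) k 1%R <->
    exists s, monomial_pc_refutation (@Piso VC EC G H F) s
      /\ derivation_degree s <= k.
  rewrite derivableP; split=> [[s [ds deg]]|[s [[ds last1] deg]]].
    by exists (rcons s 1%R); split=> //; split=> //; rewrite last_rcons.
  case/lastP: s => [|s f] in ds last1 deg *.
    by move/esym/eqP: last1; rewrite oner_eq0.
  by rewrite last_rcons in last1; subst f; exists s.
rewrite -der1P; have [eqGH|neqGH] := eqVneq #|G| #|H|; last first.
  (* Unequal sizes make both sides true: Spoiler wins at once, and at the empty position all of [G]
     against all of [H] is an unbalanced block. *)
  split=> _; last by constructor 1; apply/eqP.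
  exact: derivable_card_neq.
have Gpos : 0 < #|G| by case: size2; rewrite -?eqGH; apply: ltnW.
split=> [[//||[S win]]|der1].
- by rewrite local_iso0.
- have reg := winning_strategy_in_region eqGH win.
  rewrite -mpolyX0 -set_mnm0; apply: (derivable_spoiler_wins char0 k_ge2 eqGH reg).
  by rewrite cards0.
- constructor 3; apply: region_winning_strategy => //.
  exact: (derivable1_spoiler_region eqGH char0).
Qed.
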